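(* Let $\mathcal{D}$ be a continuous distribution supported on $[0,x^* )$, $x^*\le+\infty$, with cdf $F\in D_\gamma$ for minima (so $\gamma\le 0$). For every instance of the $k$-Multi-Unit I.I.D. Min-Prophet Inequality with $n$ random variables drawn from $\mathcal{D}$, if $k\ge\log n$, there exists a single-threshold algorithm that achieves a constant competitive ratio (i.e. bounded by a constant not depending on $n$ or $k$).
   Context: $k$-Multi-Unit I.I.D. Min-Prophet Inequality: $X_1,\dots,X_n$ are i.i.d. from a known distribution $\mathcal{D}$ (independent of $n$), continuous with cdf $F$ and support $[0,x^* )$ (left endpoint $0$), and are observed sequentially with irrevocable accept/reject decisions; one must select at least $k$ of them ($k\le n$), aiming to minimize the expected sum of the selected values. A single-threshold algorithm with threshold $T$ (which may depend on $n$, $k$, $\mathcal{D}$) selects the first $k$ realizations that are at most $T$; if the number $r$ of such realizations is smaller than $k$, it is forced to select the last $k-r$ realizations regardless of value, to guarantee feasibility. The competitive ratio is $\mathbb{E}[\mathrm{ALG}]/\mathrm{OPT}$, where $\mathrm{ALG}$ is the sum of the selected values and $\mathrm{OPT}=\sum_{i=1}^k\mu_{i:n}$ is the expected sum of the $k$ smallest of $X_1,\dots,X_n$, $\mu_{i:n}$ being the expected $i$-th smallest value. For minima, $F\in D_\gamma$ means there exist $a'_n>0$, $b'_n\in\mathbb{R}$ with $\lim_{n\to\infty}(1-F(a'_nx+b'_n))^n=G^*_\gamma(x)$, where $G^*_\gamma(x)=\exp(-(1-\gamma x)^{-1/\gamma})$ for $1-\gamma x>0$ if $\gamma\neq0$,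 and $G^*_0(x)=\exp(-e^{x})$.
   Formalization: The distribution is additionally assumed to have finite mean; without this the claim fails, e.g. for 1-F(x)=(1+x)^{-1/2}, where OPT can be finite (n=100, k=10) while every single-threshold algorithm has infinite expected cost. *)

(* Defs.v *)
From HB Require Import structures.
From mathcomp Require Import all_boot all_order all_algebra.
From mathcomp Require Import all_classical all_reals all_analysis.

Set Implicit Arguments.
Unset Strict Implicit.
Unset Printing Implicit Defensive.

Import Order.TTheory GRing.Theory Num.Theory.
Import numFieldNormedType.Exports.

Local Open Scope classical_set_scope.
Local Open Scope ring_scope.

(* [cdf] in the library is the cdf of a random variable; this is the cdf of a
   law on R, with values in R. *)
Definition law_cdf (R : realType) (D : probability (measurableTypeR R) R)
    (x : R) : R :=
  fine (D `]-oo, x]%classic).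

(* Endpoints of a distribution as in extreme value theory: inf {F > 0} and
   sup {F < 1}. F may have flat stretches between them. *)
Definition left_endpoint (R : realType) (F : R -> R) : \bar R :=
  ereal_inf [set x%:E | x in [set x | 0 < F x]].

Definition right_endpoint (R : realType) (F : R -> R) : \bar R :=
  ereal_sup [set x%:E | x in [set x | F x < 1]].

(* If F is continuous this says that the law has no atom and gives mass 1 to
   [0, xstar[, where xstar may be +oo. *)
Definition continuous_on_0_xstar (R : realType) (F : R -> R)
    (xstar : \bar R) : Prop :=
  [/\ continuous F, left_endpoint F = 0%E & right_endpoint F = xstar].

(* Only meaningful for 1 - gamma * x > 0. *)
Definition Gstar (R : realType) (gamma x : R) : R :=
  if gamma == 0 then expR (- expR x)
  else expR (- ((1 - gamma * x) `^ (- gamma^-1))).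

Definition min_domain_of_attraction (R : realType) (gamma : R)
    (F : R -> R) : Prop :=
  exists a b : nat -> R, (forall n, 0 < a n) /\
    forall x, 0 < 1 - gamma * x ->
      (fun n => (1 - F (a n * x + b n)) ^+ n) @ \oo --> Gstar gamma x.

Definition mutually_independent d (Omega : measurableType d) (R : realType)
    (P : probability Omega R) (n : nat) (X : 'I_n -> {RV P >-> R}) : Prop :=
  forall (J : {set 'I_n}) (A : 'I_n -> set R), (forall i, measurable (A i)) ->
    P (\bigcap_(i in [set` J]) (X i @^-1` A i)) =
    (\prod_(i in J) P (X i @^-1` A i))%E.

Definition iid_from d (Omega : measurableType d) (R : realType)
    (P : probability Omega R) (D : probability (measurableTypeR R) R) (n : nat)
    (X : 'I_n -> {RV P >-> R}) : Prop :=
  mutually_independent X /\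
  forall i (A : set R), measurable A -> distribution P (X i) A = D A.

Definition sample d (Omega : measurableType d) (R : realType)
    (P : probability Omega R) (n : nat) (X : 'I_n -> {RV P >-> R})
    (w : Omega) : seq R :=
  [seq X i w | i <- enum 'I_n].

(* The values selected, in order of arrival, when k more units are needed and
   the values s are still to come. A value is taken if it is at most T, or if
   no more than k values are left, itself included; in the latter case all the
   remaining values end up being selected. *)
Fixpoint threshold_select (R : realType) (T : R) (k : nat) (s : seq R)
    : seq R :=
  match s, k with
  | x :: s', k'.+1 =>
      if (x <= T) || (size s <= k)%N then x :: threshold_select T k' s'
      else threshold_select T k s'
  | _, _ => [::]
  end.

Lemma size_threshold_select (R : realType) (T : R) (k : nat) (s : seq R) :
  (k <= size s)%N -> size (threshold_select T k s) = k.
Proof.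
elim: s k => [|x s IH] [|k] //= ks.
case: ifP => [_|/norP[_]]; first by rewrite /= IH.
by rewrite -ltnNge ltnS => /IH.
Qed.

Definition ALG (R : realType) (T : R) (k : nat) (s : seq R) : R :=
  \sum_(x <- threshold_select T k s) x.

(* 0-indexed: [order_stat 0] is the minimum. *)
Definition order_stat (R : realType) (i : nat) (s : seq R) : R :=
  nth 0 (sort <=%R s) i.

Definition OPT d (Omega : measurableType d) (R : realType)
    (P : probability Omega R) (n : nat) (X : 'I_n -> {RV P >-> R}) (k : nat)
    : \bar R :=
  (\sum_(i < k) 'E_P[fun w => order_stat i (sample X w)])%E.

Definition competitive_ratio d (Omega : measurableType d) (R : realType)
    (P : probability Omega R) (n : nat) (X : 'I_n -> {RV P >-> R}) (k : nat)
    (T : R) : \bar R :=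
  ('E_P[fun w => ALG T k (sample X w)] / OPT X k)%E.

(* Main.v *)
Require Import Defs.
From HB Require Import structures.
From mathcomp Require Import all_boot all_order all_algebra.
From mathcomp Require Import all_classical all_reals all_analysis.
From mathcomp Require Import measurable_realfun ring lra.

Set Implicit Arguments.
Unset Strict Implicit.
Unset Printing Implicit Defensive.

Import Order.TTheory GRing.Theory Num.Theory.
Import numFieldNormedType.Exports.

Local Open Scope classical_set_scope.
Local Open Scope ring_scope.

(* Membership in D_gamma is only used through its consequence that, on some
   ]0, x0], F at least doubles when its argument is multiplied by a constant lam.
   Iterating, a point t with F t = k / (2 n) satisfies t >= x0 / lam ^ (2 k + 2)
   as soon as n <= e ^ k, and T = lam ^ (m + 1) * t has F T >= 2 ^ m * k / n.

   OPT >= t * (k - E #{i | X_i <= t}) = t * k / 2. If at least k values are at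
   most T, then ALG <= k * T; otherwise ALG <= sum_i |X_i|, and by Chernoff this
   case contributes at most n * mu * 2 ^ k * (1 - F T / 2) ^ (n - 1), with mu the
   mean; for m large this is at most a constant times the lower bound on t. When
   k / (2 n) exceeds a fixed constant, OPT is at least a constant times k, and
   ALG <= n * mu holds for any threshold. *)

(** * Extreme value theory: doubling of [F] near 0 *)

Section MinDomainOfAttraction.
Variable R : realType.
Implicit Types (F : R -> R) (gamma x y : R).

(** Inverts the exponent of [Gstar], so that [(1 - F)^n] along [a n * u + b n] can be given any
    limit strictly between 0 and 1. *)
Lemma Gstar_expR_surj gamma (c : R) : 0 < c ->
  exists2 u, 0 < 1 - gamma * u & Gstar gamma u = expR (- c).
Proof.
move=> c0; rewrite /Gstar; have [->|g0] := eqVneq gamma 0.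
  by exists (ln c); rewrite ?mul0r ?subr0// lnK.
exists ((1 - c `^ (- gamma)) / gamma).
  by rewrite mulrC divfK// opprB addrC subrK powR_gt0.
rewrite mulrC divfK// opprB addrC subrK -powRrM.
by rewrite mulrN mulNr opprK divff// powRr1// ltW.
Qed.

Lemma Gstar_lt1 gamma x : 0 < 1 - gamma * x -> Gstar gamma x < 1.
Proof.
move=> gx; rewrite /Gstar; case: ifP => _;
  by rewrite expR_lt1 oppr_lt0 ?expR_gt0 ?powR_gt0.
Qed.

Lemma Gstar0 gamma : Gstar gamma 0 = expR (- 1).
Proof. by rewrite /Gstar mulr0 subr0 powR1 expR0; case: ifP. Qed.

(** After inversion this is 1 / (1 - x) <= 1 + 2 x <= exp (2 x), where the first inequality needs x
    <= 1/2. *)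
Lemma expR_le_1Bx x : 0 <= x <= 2^-1 -> expR (- (2 * x)) <= 1 - x.
Proof.
move=> /andP[x0 x1]; rewrite expRN -[leRHS]invrK lef_pV2 ?posrE ?expR_gt0//;
  last by rewrite invr_gt0; lra.
apply: le_trans (expR_ge1Dx _).
by rewrite -[leLHS]mul1r ler_pdivrMr; nra.
Qed.

(** Converse of [powB_le_expR] up to a factor 2 in the exponent; it turns smallness of [(1 - F)^n]
    into a lower bound on [F]. *)
Lemma expR_le_powB (n : nat) (c : R) : 0 < c -> 2 * c <= n%:R ->
  expR (- (2 * c)) <= (1 - c / n%:R) ^+ n.
Proof.
move=> c0 cn; have n0 : 0 < n%:R :> R by lra.
have -> : - (2 * c) = - (2 * (c / n%:R)) * n%:R by field; lra.
rewrite expRM_natr lerXn2r ?nnegrE ?expR_ge0//.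
  by rewrite subr_ge0 ler_pdivrMr//; lra.
apply: expR_le_1Bx; apply/andP; split; first by rewrite divr_ge0// ltW.
by rewrite ler_pdivrMr//; lra.
Qed.

Lemma powB_le_expR (n : nat) (p : R) : p <= 1 ->
  (1 - p) ^+ n <= expR (- (p * n%:R)).
Proof.
move=> p1; rewrite -mulNr expRM_natr lerXn2r ?nnegrE ?expR_ge0 ?subr_ge0//.
exact: expR_ge1Dx.
Qed.

(* With n of order 2 / F y, the bounds at b_n and at a_n u + b_n force
   b_n < y and F (a_n u + b_n) >= 6 / n, while F (b_n - a_n v) > 0 bounds
   a_n / b_n, so that a_n u + b_n <= lam * b_n. *)
Lemma min_domain_of_attraction_doubling gamma F :
  {homo F : x y / x <= y} -> (forall x, F x <= 1) -> (forall x, 0 <= F x) ->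
  (forall x, x <= 0 -> F x = 0) -> (forall x, 0 < x -> 0 < F x) ->
  {for 0, continuous F} ->
  min_domain_of_attraction gamma F ->
  exists lam x0, [/\ 1 < lam, 0 < x0 &
    forall y, 0 < y <= x0 -> 2 * F y <= F (lam * y)].
Proof.
move=> Fnd F1 F0 Fneg Fpos Fc [a [b [a0 ab]]].
(* Any level above 12 = 2 * 6 would do: the target for [F] is 6 / n, which is at least 2 F y when n
   <= 3 / F y, and the other 2 comes from [expR_le_powB]. *)
have [u udom uG] := @Gstar_expR_surj gamma 13 (ltr0Sn _ 12).
(* This keeps [- v] in the domain of [Gstar] whatever the sign of [gamma]. *)
pose v : R := (1 + `|gamma|)^-1.
have v0 : 0 < v by rewrite invr_gt0; have := normr_ge0 gamma; lra.
have vdom : 0 < 1 - gamma * (- v).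
  have -> : 1 - gamma * (- v) = (1 + `|gamma| + gamma) * v.
    by rewrite /v; field; have := normr_ge0 gamma; lra.
  by rewrite mulr_gt0//; have := lerNnormlW (lexx `|gamma|); lra.
have dom0 : 0 < 1 - gamma * 0 by rewrite mulr0 subr0.
have E1 : \forall n \near \oo, expR (- 2) < (1 - F (b n)) ^+ n.
  have := ab 0 dom0; rewrite Gstar0 => /cvgr_gt; move=> /(_ (expR (- 2))).
  rewrite ltr_expR ltrN2 ltr1n => /(_ isT); apply: filterS => n.
  by rewrite mulr0 add0r.
have E2 : \forall n \near \oo, (1 - F (a n * u + b n)) ^+ n < expR (- 12).
  have := ab u udom; rewrite uG => /cvgr_lt; apply.
  by rewrite ltr_expR ltrN2 ltr_nat.
have E3 : \forall n \near \oo, (1 - F (a n * (- v) + b n)) ^+ n < 1.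
  by have := ab _ vdom => /cvgr_lt; apply; exact: Gstar_lt1.
have [N _ HN] : \forall n \near \oo, [/\ expR (- 2) < (1 - F (b n)) ^+ n,
   (1 - F (a n * u + b n)) ^+ n < expR (- 12) &
   (1 - F (a n * (- v) + b n)) ^+ n < 1].
  by near=> n; split; near: n.
(* The 12 provides the hypothesis 2 * 6 <= n of [expR_le_powB]; [x0] is then so small that y <= x0
   forces n > M. *)
pose M := maxn N 12.
have [x0 x00 Fx0] : exists2 x0, 0 < x0 & F x0 <= 2 / M.+1%:R.
  have : \forall x \near (0 : R), F x < 2 / M.+1%:R.
    have /cvgr_lt := Fc; apply; rewrite Fneg// divr_gt0//.
  case/nbhs_ballP => e /= e0 He; exists (e / 2); first by rewrite divr_gt0.
  apply/ltW/He; rewrite /ball/= sub0r normrN gtr0_norm ?divr_gt0//.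
  by rewrite ltr_pdivrMr//; lra.
(* From [a n * v < b n] comes [a n * u <= |u| / v * b n]; the 2 rather than 1 gives [1 < lam]
   without checking that u is nonzero. *)
exists (2 + `|u| / v), x0; split => //.
  by have := divr_ge0 (normr_ge0 u) (ltW v0); lra.
move=> y /andP[y0 yx0].
have Fy0 := Fpos _ y0.
(* Thus 2 / F y < n <= 3 / F y, the upper bound by F y <= 1. *)
pose n := (Num.truncn (2 / F y)).+1.
have n0 : 0 < n%:R :> R by rewrite ltr0n.
have nl : 2 / F y < n%:R by exact: truncnS_gt.
have nu : n%:R <= 3 / F y.
  have : n%:R <= 2 / F y + 1.
    by rewrite /n -natr1 lerD2r truncn_le// divr_ge0// ltW.
  move=> /le_trans; apply; rewrite (_ : 3 / F y = 2 / F y + 1 / F y); last by lra.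
  by rewrite lerD2l ler_pdivlMr// mul1r.
have Mn : (M <= n)%N.
  rewrite -(ler_nat R); apply: (le_trans _ (ltW nl)).
  have Fyx : F y <= 2 / M.+1%:R by apply: le_trans Fx0; exact: Fnd.
  rewrite ler_pdivlMr// mulrC.
  move: Fyx; rewrite ler_pdivlMr ?ltr0n// => /(le_trans _); apply.
  by rewrite ler_wpM2l// ler_nat.
have nN : (N <= n)%N by apply: leq_trans Mn; exact: leq_maxl.
have n12 : 12 <= n%:R :> R by rewrite ler_nat; apply: leq_trans Mn; exact: leq_maxr.
have [H1 H2 H3] := HN n nN.
have by_ : b n < y.
  rewrite ltNge; apply/negP => yb; move: H1; apply/negP; rewrite -leNgt.
  apply: le_trans (powB_le_expR _ (F1 _)) _; rewrite ler_expR lerN2.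
  have : F y <= F (b n) by exact: Fnd.
  by move: nl; rewrite ltr_pdivrMr// => ? ?; nra.
have F6 : 6 / n%:R <= F (a n * u + b n).
  rewrite leNgt; apply/negP => F6; move: H2; apply/negP; rewrite -leNgt.
  have -> : 12 = 2 * 6 :> R by lra.
  apply: le_trans (@expR_le_powB n 6 _ _) _ => //; first by lra.
  have c1 : 6 / n%:R <= 1 :> R by rewrite ler_pdivrMr// mul1r; lra.
  by rewrite lerXn2r ?nnegrE ?subr_ge0//; lra.
(* [F] vanishes on nonpositive arguments, so otherwise the power in [H3] would be 1. *)
have bav : a n * v < b n.
  rewrite ltNge; apply/negP => bav; move: H3.
  by rewrite Fneg ?subr0 ?expr1n ?ltxx// mulrN; lra.
have zy : a n * u + b n <= (2 + `|u| / v) * y.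
  have an : a n <= b n / v by rewrite ler_pdivlMr// ltW.
  have au : a n * u <= `|u| / v * b n.
    apply: (@le_trans _ _ (a n * `|u|)).
      by rewrite ler_wpM2l ?(ltW (a0 _))// ler_norm.
    by rewrite (_ : _ / v * _ = b n / v * `|u|); [exact: ler_wpM2r|ring].
  have uv : 0 <= `|u| / v by rewrite divr_ge0// ltW.
  nra.
apply: le_trans (Fnd _ _ zy); apply: le_trans F6.
rewrite ler_pdivlMr//; move: nu; rewrite ler_pdivlMr//; lra.
Unshelve. all: by end_near.
Qed.

(** Only lam^m y has to be below [x0] for m + 1 doublings, as the last one starts there. *)
Lemma iter_doubling F lam x0 : 1 < lam ->
  (forall y, 0 < y <= x0 -> 2 * F y <= F (lam * y)) ->
  forall m y, 0 < y -> lam ^+ m * y <= x0 ->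
  2 ^+ m.+1 * F y <= F (lam ^+ m.+1 * y).
Proof.
move=> lam1 Fdbl; elim=> [|m IH] y y0; rewrite ?expr0 ?mul1r ?expr1 => yx.
  by apply: Fdbl; rewrite y0.
have lam0 : 0 < lam by lra.
have yx' : lam ^+ m * (lam * y) <= x0 by rewrite mulrA -exprSr.
rewrite exprSr -mulrA [lam ^+ _]exprSr -mulrA.
apply: le_trans (IH _ _ yx'); last by rewrite mulr_gt0.
rewrite ler_wpM2l ?exprn_ge0//; apply: Fdbl; rewrite y0 (le_trans _ yx)//.
by rewrite ler_peMl ?(ltW y0)// exprn_ege1// ltW.
Qed.

(** Otherwise [N + 1] doublings would push [F] above 1. *)
Lemma doubling_lower_bound F lam x0 (N : nat) y : 1 < lam -> 0 < x0 ->
  (forall y, 0 < y <= x0 -> 2 * F y <= F (lam * y)) ->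
  (forall x, F x <= 1) -> 0 < y -> 1 < 2 ^+ N * F y -> x0 < lam ^+ N * y.
Proof.
move=> lam1 x00 Fdbl F1 y0 FN; rewrite ltNge; apply/negP => yx.
have := iter_doubling lam1 Fdbl y0 yx; apply/negP; rewrite -ltNge.
apply: le_lt_trans (F1 _) _; apply: (lt_trans FN).
have Fy : 0 < F y.
  by move: FN; case: (ltP 0 (F y)) => // Fy; have := exprn_gt0 N (ltr0Sn R 1); nra.
by rewrite ltr_pM2r// ltr_eXn2l ?ltr1n.
Qed.

End MinDomainOfAttraction.

(** * Pathwise bounds on the selected values and on order statistics *)

Section Selection.
Variable R : realType.
Implicit Types (T x t : R) (k : nat) (s : seq R).

(** A value above [T] is never forced here: the tail still holds [k] values at most [T], so more
    than [k] values are left. *)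
Lemma threshold_select_le T k s : (k <= count (<= T) s)%N ->
  all (<= T) (threshold_select T k s).
Proof.
elim: s k => [|x s IH] [|k] //=.
have [xT /=|xT /=] := boolP (x <= T); first by rewrite add1n ltnS => /IH ->; rewrite xT.
rewrite add0n => kc; rewrite ltnS leqNgt (leq_trans kc (count_size _ _))/=.
exact: IH.
Qed.

Lemma ALG_le_norm T k s : ALG T k s <= \sum_(x <- s) `|x|.
Proof.
rewrite /ALG; elim: s k => [|x s IH] [|k] //=; rewrite ?big_nil//.
  by rewrite sumr_ge0.
rewrite big_cons; case: ifP => _; first by rewrite big_cons lerD// ler_norm.
by apply: le_trans (IH _) _; rewrite lerDr.
Qed.

Lemma ALG_le_threshold T k s : (k <= count (<= T) s)%N -> ALG T k s <= k%:R * T.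
Proof.
move=> kc; have ks : (k <= size s)%N := leq_trans kc (count_size _ _).
rewrite /ALG -[k in k%:R](size_threshold_select T ks).
elim: (threshold_select T k s) (threshold_select_le kc) => [_|x r IH /= /andP[xT rT]].
  by rewrite big_nil mul0r.
by rewrite big_cons -natr1 mulrDl mul1r addrC lerD// IH.
Qed.

(** Otherwise the first [i + 1] entries of the sorted sequence would all be at most [t], against the
    count. *)
Lemma lt_order_stat t s i : (i < size s)%N -> (count (<= t) s <= i)%N ->
  t < order_stat i s.
Proof.
move=> si; rewrite -(count_sort <=%R) -(size_sort <=%R) in si *.
rewrite ltNge /order_stat; apply: contraTN => st.
rewrite -ltnNge -(cat_take_drop i.+1 (sort _ s)) count_cat.
have := sort_sorted le_total s; set r := sort _ s in si st *.
move=> /(sorted_leq_nth le_trans le_refl 0) rs.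
suff /eqP -> : count (<= t) (take i.+1 r) == i.+1 by rewrite leq_addr.
rewrite -[X in _ == X](size_takel si) -all_count.
apply/(all_nthP 0) => j; rewrite size_takel// => ji.
rewrite nth_take//; apply: le_trans st; apply: rs; rewrite ?inE//.
exact: leq_trans ji si.
Qed.

Lemma order_stat_mem s i : (i < size s)%N -> order_stat i s \in s.
Proof. by move=> si; rewrite -(mem_sort <=%R) mem_nth// size_sort. Qed.

(** The sum is the truncated difference of [k] and [h]; with [h] the number of values at most [t],
    it counts the order statistics of rank below [k] that exceed [t]. *)
Lemma leq_sum_ltnS (h k : nat) : (k <= \sum_(j < k) (h < j.+1)%N + h)%N.
Proof.
elim: k => [//|k IH]; rewrite big_ord_recr/= [(h < _)%N]ltnS; have [hk|hk] := leqP h k.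
  by rewrite addnAC addn1.
by rewrite addn0 (leq_trans hk)// leq_addl.
Qed.

End Selection.

(** * Consequences of continuity and left endpoint 0 for the law *)

Section LawCdf.
Variables (R : realType) (D : probability (measurableTypeR R) R).
Let F := law_cdf D.
Implicit Types x y : R.

Lemma EFin_law_cdf x : (F x)%:E = D `]-oo, x]%classic.
Proof. by rewrite /F /law_cdf fineK// fin_num_measure. Qed.

Lemma law_cdf_ge0 x : 0 <= F x.
Proof. by rewrite -lee_fin EFin_law_cdf. Qed.

Lemma law_cdf_le1 x : F x <= 1.
Proof. by rewrite -lee_fin EFin_law_cdf probability_le1. Qed.

Lemma le_law_cdf : {homo F : x y / x <= y}.
Proof.
move=> x y xy; rewrite -lee_fin !EFin_law_cdf le_measure ?inE//.
by apply: subset_itvl; rewrite bnd_simp.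
Qed.

Variable xstar : \bar R.
Hypothesis hD : continuous_on_0_xstar F xstar.

(** If [F 0] were positive, continuity would make [F] positive at some negative point, below the
    left endpoint. *)
Lemma law_cdf_eq0 x : x <= 0 -> F x = 0.
Proof.
case: hD => Fc lF _.
suff F00 : F 0 <= 0.
  move=> x0; apply/eqP; rewrite eq_le law_cdf_ge0 andbT.
  exact: le_trans (le_law_cdf x0) F00.
rewrite leNgt; apply/negP => F0.
have : \forall y \near (0 : R), 0 < F y by have /cvgr_gt := Fc 0; apply.
case/nbhs_ballP => e /= e0 He.
have : ((- (e / 2))%:E < 0)%E by rewrite lte_fin oppr_lt0 divr_gt0.
apply/negP; rewrite -leNgt -lF; apply: ereal_inf_lbound; exists (- (e / 2)) => //=.
apply: He; rewrite /ball/= sub0r opprK gtr0_norm ?divr_gt0//.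
by rewrite ltr_pdivrMr//; lra.
Qed.

Lemma law_cdf_gt0 x : 0 < x -> 0 < F x.
Proof.
case: hD => _ lF _ x0.
have : (left_endpoint F < x%:E)%E by rewrite lF lte_fin.
move=> /ereal_inf_lt[_ [y /= Fy <-]]; rewrite lte_fin => yx.
by apply: lt_le_trans Fy _; apply: le_law_cdf; exact: ltW.
Qed.

Lemma law_cdf_surj p y : 0 <= p <= F y -> 0 <= y -> exists2 x, 0 <= x <= y & F x = p.
Proof.
case: hD => Fc _ _ /andP[p0 py] y0.
have [|x] := @IVT R F 0 y p y0 (continuous_subspaceT Fc).
  by rewrite law_cdf_eq0// min_l ?max_r ?law_cdf_ge0// p0.
by rewrite in_itv/= => xy <-; exists x.
Qed.

(** Values are nonnegative only almost surely; this discards the null set of negative ones. *)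
Lemma integral_neg_part : (\int[D]_x (Num.max (- x) 0)%:E = 0)%E.
Proof.
rewrite (@ge0_negligible_integral _ (measurableTypeR R) _ D setT `]-oo, (0 : R)]%classic)//=.
- apply: integral0_eq => x [_ /=]; rewrite in_itv/= => /negP; rewrite -ltNge => x0.
  by rewrite max_r// oppr_le0 ltW.
- by apply/measurable_EFinP; apply: measurable_maxr => //; exact: measurable_oppr.
- by move=> x _; rewrite lee_fin le_max lexx orbT.
- by rewrite -EFin_law_cdf law_cdf_eq0.
Qed.

(** The expectation is the integral of the positive part minus that of the negative part, and the
    latter is 0. *)
Lemma integral_norm_lty : ('E_D[fun x => x] < +oo)%E ->
  (\int[D]_x (`|x|)%:E < +oo)%E.
Proof.
have mid : measurable_fun [set: measurableTypeR R] (fun x : R => (Num.max x 0)%:E).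
  by apply/measurable_EFinP; apply: measurable_maxr => //; exact: measurable_id.
have mneg : measurable_fun [set: measurableTypeR R] (fun x : R => (Num.max (- x) 0)%:E).
  by apply/measurable_EFinP; apply: measurable_maxr => //; exact: measurable_oppr.
rewrite unlock integralE.
have -> : (\int[D]_x ((fun w : R => w%:E)^\- x) = 0)%E.
  rewrite -[RHS]integral_neg_part; apply: eq_integral => x _.
  by rewrite funenegE -EFin_max.
rewrite sube0 => pos.
under eq_integral => x _.
  have -> : (`|x|%:E = (Num.max x 0)%:E + (Num.max (- x) 0)%:E)%E.
    rewrite -EFinD; congr EFin; have [x0|x0] := orP (le_total 0 x).
      by rewrite ger0_norm// max_l// max_r ?addr0// oppr_le0.
    by rewrite ler0_norm// max_r// max_l ?add0r// oppr_ge0.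
  over.
rewrite ge0_integralD//=; do ?by move=> x _; rewrite lee_fin le_max lexx orbT.
rewrite integral_neg_part adde0; apply: le_lt_trans pos; rewrite le_eqVlt; apply/orP; left.
by apply/eqP/eq_integral => x _; rewrite funeposE -EFin_max.
Qed.

End LawCdf.

(** * Comparison of integrals and of measures *)

Section IntegralBounds.
Context d (Omega : measurableType d) (R : realType).
Variable mu : {measure set Omega -> \bar R}.
Local Open Scope ereal_scope.

(* The integral is a supremum over simple functions, so monotonicity needs no
   measurability; the measurability of ALG and of order_stat is never used. *)
Lemma ge0_le_integral_nomeas (f g : Omega -> \bar R) :
  (forall w, 0 <= f w) -> (forall w, f w <= g w) ->
  \int[mu]_w f w <= \int[mu]_w g w.
Proof.
move=> f0 fg; have g0 w : 0 <= g w := le_trans (f0 w) (fg w).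
rewrite !ge0_integralTE//= ge_ereal_sup// => _ [h/= hf] <-.
by apply: ereal_sup_ubound; exists h => // w; apply: le_trans (fg w).
Qed.

Lemma le_integral_nomeas (f g : Omega -> \bar R) :
  (forall w, 0 <= g w) -> (forall w, f w <= g w) ->
  \int[mu]_w f w <= \int[mu]_w g w.
Proof.
move=> g0 fg; rewrite integralE -[leRHS]sube0; apply: leeB.
  by apply: ge0_le_integral_nomeas => w; rewrite funeposE ?le_max ?lexx ?orbT// ge_max fg g0.
by apply: integral_ge0 => w _; rewrite funenegE le_max lexx orbT.
Qed.

(** [h] dominates the negative part of [f], which therefore integrates to 0. In the application [f]
    is an order statistic. *)
Lemma integral_ge_nomeas (f g h : Omega -> \bar R) :
  (forall w, 0 <= g w) -> (forall w, g w <= maxe (f w) 0) ->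
  (forall w, maxe (- f w) 0 <= h w) -> \int[mu]_w h w = 0 ->
  \int[mu]_w g w <= \int[mu]_w f w.
Proof.
move=> g0 gf fh h0; rewrite [leRHS]integralE.
have -> : \int[mu]_w f^\- w = 0.
  apply/eqP; rewrite eq_le integral_ge0 ?andbT; last first.
    by move=> w _; rewrite funenegE le_max lexx orbT.
  rewrite -[leRHS]h0; apply: ge0_le_integral_nomeas => w; rewrite funenegE//.
  by rewrite le_max lexx orbT.
by rewrite sube0; apply: ge0_le_integral_nomeas => // w; rewrite funeposE.
Qed.

Lemma measure_bigsetU_le (I : Type) (r : seq I) (Q : pred I) (E : I -> set Omega) :
  (forall i, Q i -> measurable (E i)) ->
  mu (\big[setU/set0]_(i <- r | Q i) E i) <= \sum_(i <- r | Q i) mu (E i).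
Proof.
move=> mE; suff [] : measurable (\big[setU/set0]_(i <- r | Q i) E i) /\
  mu (\big[setU/set0]_(i <- r | Q i) E i) <= \sum_(i <- r | Q i) mu (E i) by [].
apply: (big_ind2 (fun A (x : \bar R) => measurable A /\ mu A <= x)).
- by rewrite measure0.
- move=> A x B y [mA Ax] [mB By]; split; first exact: measurableU.
  by apply: le_trans (measureU2 mu mA mB) _; exact: leeD.
- by move=> i Qi; split => //; exact: mE.
Qed.

(** Moves an event from the domain into the measure, the form required by [ge0_le_integral_comp]. *)
Lemma ge0_integral_mrestr (A : set Omega) (mA : measurable A) (f : Omega -> \bar R) :
  measurable_fun setT f -> (forall w, 0 <= f w) ->
  \int[mrestr mu mA]_w f w = \int[mu]_(w in A) f w.
Proof.
move=> mf f0.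
rewrite (@ge0_negligible_integral _ _ _ _ setT (~` A))//=.
- rewrite setTD setCK; apply: eq_measure_integral => B mB BA.
  by rewrite /= /mrestr setIidl.
- exact: measurableC.
- by rewrite /mrestr setICl.
Qed.

End IntegralBounds.

(** Setwise domination of the pushforward of [mu1] extends to integrals. It serves with c = 1 for
    equality in law, and with Chernoff's factor for the restriction of [P] to an event. *)
Lemma ge0_le_integral_comp d1 d2 (T1 : measurableType d1) (T2 : measurableType d2)
    (R : realType) (mu1 : {measure set T1 -> \bar R})
    (mu2 : {measure set T2 -> \bar R}) (phi : T1 -> T2) (f : T2 -> \bar R) (c : R) :
  measurable_fun setT phi -> measurable_fun setT f -> (forall x, 0 <= f x)%E ->
  0 <= c ->
  (forall A, measurable A -> mu1 (phi @^-1` A) <= c%:E * mu2 A)%E ->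
  (\int[mu1]_x f (phi x) <= c%:E * \int[mu2]_x f x)%E.
Proof.
move=> mphi mf f0 c0 mu12.
pose phi' : {mfun T1 >-> T2} := HB.pack phi (isMeasurableFun.Build _ _ _ _ phi mphi).
have <- : (\int[pushforward mu1 phi']_y f y = \int[mu1]_x f (phi x))%E.
  by rewrite ge0_integral_pushforward.
rewrite -[leRHS](ge0_integral_mscale mu2 measurableT (NngNum c0))//.
by apply: ge0_le_measure_integral => // A mA; exact: mu12.
Qed.

(** * Bounds on [ALG] and [OPT] for an i.i.d. sample *)

Section Sample.
Context d (Omega : measurableType d) (R : realType) (P : probability Omega R).
Variables (D : probability (measurableTypeR R) R) (n : nat).
Variable X : 'I_n -> {RV P >-> R}.
Hypothesis hX : iid_from D X.
Implicit Types (T t : R) (i l : 'I_n) (k : nat) (w : Omega).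

Lemma iid_joint (A : 'I_n -> set R) : (forall l, measurable (A l)) ->
  measurable [set w | forall l, A l (X l w)] /\
  P [set w | forall l, A l (X l w)] = (\prod_l fine (D (A l)))%:E.
Proof.
move=> mA; have [indep law] := hX.
have -> : [set w | forall l, A l (X l w)] =
    \bigcap_(l in [set` [set: 'I_n]%SET]) (X l @^-1` A l).
  apply/seteqP; split => w Aw; [move=> l _; exact: Aw |].
  by move=> l; apply: Aw; rewrite /= finset.in_setT.
split.
  apply: fin_bigcap_measurable => // l _.
  exact: measurable_funPTI.
rewrite indep// -prodEFin; apply: eq_big => [l|l _]; first by rewrite finset.in_setT.
have := law l _ (mA l); rewrite /distribution /pushforward => ->.
by rewrite fineK//; apply: fin_num_measure; exact: mA.
Qed.

Definition hits T w : nat := #|[pred i | X i w <= T]|.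

Lemma count_sample T w : count (<= T) (sample X w) = hits T w.
Proof.
rewrite /sample /hits -sum1_count big_map -sum1_card big_enum_cond/=.
by apply: eq_bigl => i; rewrite inE.
Qed.

Lemma size_sample w : size (sample X w) = n.
Proof. by rewrite size_map size_enum_ord. Qed.

(** [S] is the exact set of indices whose value is at most [T]; fixing it gives a product event. [A]
    leaves room for one more constraint on each coordinate. *)
Let pattern T (A : 'I_n -> set R) (S : {set 'I_n}) l : set R :=
  (if l \in S then `]-oo, T] else `]T, +oo[)%classic `&` A l.

Let measurable_pattern T A S l : (forall l, measurable (A l)) ->
  measurable (pattern T A S l).
Proof. by move=> mA; apply: measurableI => //; case: ifP. Qed.

Let hits_lt_pattern T k (A : 'I_n -> set R) :
  [set w | (hits T w < k)%N /\ forall l, A l (X l w)] =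
  \big[setU/set0]_(S : {set 'I_n} | (#|S| < k)%N)
    [set w | forall l, pattern T A S l (X l w)].
Proof.
rewrite -bigcup_pred; apply/seteqP; split => w /=.
  move=> [hk Aw]; exists [set i | X i w <= T]%SET => /=.
    by rewrite unfold_in cardsE.
  by move=> l; split => //; rewrite inE; case: ifPn; rewrite /= in_itv/= ?andbT// -ltNge.
move=> [S /= Sk HS]; split; last by move=> l; have [] := HS l.
rewrite /hits (@eq_card _ _ (mem S))// => l; rewrite inE.
by have [] := HS l; case: ifPn => lS; rewrite /= in_itv/= ?andbT// ltNge => /negbTE.
Qed.

Lemma measurable_hits_lt T k : measurable [set w | (hits T w < k)%N].
Proof.
have -> : [set w | (hits T w < k)%N] =
    [set w | (hits T w < k)%N /\ forall l, [set: R] (X l w)].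
  by apply/seteqP; split => w //= [].
rewrite (hits_lt_pattern T k (fun=> setT)); apply: bigsetU_measurable => S _.
by apply: (iid_joint _).1 => l; exact: measurable_pattern.
Qed.

(* Chernoff's bound at parameter 2: 1_{hits < k} <= 2 ^ (k - hits), and
   expanding over the set of hits makes the latter a product over the sample. *)
Lemma hits_lt_bound T k i (A : set R) : measurable A ->
  (P ([set w | (hits T w < k)%N] `&` X i @^-1` A) <=
   (2 ^+ k * (1 - law_cdf D T / 2) ^+ n.-1)%:E * D A)%E.
Proof.
move=> mA; pose A_ l : set R := if l == i then A else [set: R].
have mA_ l : measurable (A_ l) by rewrite /A_; case: ifP.
have -> : [set w | (hits T w < k)%N] `&` X i @^-1` A =
    [set w | (hits T w < k)%N /\ forall l, A_ l (X l w)].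
  apply/seteqP; split => w /= [hk Aw]; split => //.
    by move=> l; rewrite /A_; case: eqP => // ->.
  by have := Aw i; rewrite /A_ eqxx.
rewrite hits_lt_pattern.
apply: le_trans (measure_bigsetU_le _ _ _) _.
  by move=> S _; apply: (iid_joint _).1 => l; exact: measurable_pattern.
rewrite (eq_bigr (fun S => (\prod_l fine (D (pattern T A_ S l)))%:E)); last first.
  by move=> S _; apply: (iid_joint _).2 => l; exact: measurable_pattern.
rewrite sumEFin -[D A]fineK ?fin_num_measure// -EFinM lee_fin.
pose f l := fine (D (`]-oo, T]%classic `&` A_ l)).
pose g l := fine (D (`]T, +oo[%classic `&` A_ l)).
have f0 l : 0 <= f l by exact: fine_ge0.
have g0 l : 0 <= g l by exact: fine_ge0.
have mlo l : measurable (`]-oo, T]%classic `&` A_ l) by apply: measurableI => //; exact: mA_.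
have mhi l : measurable (`]T, +oo[%classic `&` A_ l) by apply: measurableI => //; exact: mA_.
have fg l : f l + g l = fine (D (A_ l)).
  have -> : D (A_ l) = (D (`]-oo, T]%classic `&` A_ l) + D (`]T, +oo[%classic `&` A_ l))%E.
    rewrite -measureU; [|exact: mlo|exact: mhi|].
      rewrite -setIUl (_ : _ `|` _ = setT) ?setTI//.
      by apply/seteqP; split => // x _ /=; rewrite !in_itv/= andbT; case: leP; [left|right].
    apply/seteqP; split => // x /= [[]]; rewrite !in_itv/= andbT => xT _ [].
    by rewrite ltNge xT.
  by rewrite fineD//; apply: fin_num_measure; [exact: mlo|exact: mhi].
(* Each hit is worth a factor 2, compensated by halving [f l]; then #|S| < k bounds the power by
   2^k. *)
have prodE (S : {set 'I_n}) : \prod_l fine (D (pattern T A_ S l)) =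
    2 ^+ #|S| * \prod_l (if l \in S then f l / 2 else g l).
  have -> : 2 ^+ #|S| = \prod_l (if l \in S then 2 else 1) :> R.
    by rewrite -big_mkcond prodr_const.
  rewrite -big_split/=; apply: eq_bigr => l _.
  by rewrite /pattern /f /g; case: ifP => _; rewrite ?mul1r// mulrC divfK.
apply: (@le_trans _ _ (2 ^+ k * \prod_l (f l / 2 + g l))).
  (* The product expands over all [S]; those with #|S| >= k only add nonnegative terms. *)
  rewrite bigA_distr mulr_sumr [leRHS](bigID (fun S : {set 'I_n} => (#|S| < k)%N))/=.
  have h0 (S : {set 'I_n}) : 0 <= \prod_l (if l \in S then f l / 2 else g l).
    by apply: prodr_ge0 => l _; case: ifP => _; rewrite ?divr_ge0.
  rewrite ler_wpDr//; first by apply: sumr_ge0 => S _; rewrite mulr_ge0// exprn_ge0.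
  apply: ler_sum => S Sk; rewrite prodE ler_wpM2r// ler_weXn2l ?ler1n//.
  exact: ltnW.
rewrite -mulrA ler_wpM2l ?exprn_ge0//.
(* Coordinate [i] is spent on [A] and contributes at most [D A]; the other n - 1 give 1 - F T / 2
   each. *)
rewrite (bigD1 i)//= mulrC.
have -> : \prod_(l | l != i) (f l / 2 + g l) = (1 - law_cdf D T / 2) ^+ n.-1.
  have -> : n.-1 = #|[pred l | l != i]| by rewrite cardC1 card_ord.
  rewrite -prodr_const; apply: eq_bigr => l /negbTE li.
  have := fg l; rewrite /f /g /A_ li !setIT probability_setT/= /law_cdf.
  by move: (fine _) (fine _) => a b; lra.
have -> : D A = D (A_ i) by rewrite /A_ eqxx.
rewrite ler_wpM2l//.
  apply: exprn_ge0; have := law_cdf_le1 D T; lra.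
by rewrite -fg; have := f0 i; lra.
Qed.

Let mX i : measurable_fun setT (X i : Omega -> measurableTypeR R).
Proof. by move=> mT A mA; exact: (@measurable_funPT _ _ _ _ (X i) mT A mA). Qed.

Lemma ge0_le_integral_iid i (phi : measurableTypeR R -> R) :
  measurable_fun setT phi -> (forall x, 0 <= phi x) ->
  (\int[P]_w (phi (X i w))%:E <= \int[D]_x (phi x)%:E)%E.
Proof.
move=> mphi phi0; rewrite -[leRHS]mul1e.
apply: (@ge0_le_integral_comp _ _ _ _ _ P D (X i) (EFin \o phi)) => //=.
- exact/measurable_EFinP.
- by move=> A mA; rewrite mul1e; have [_ law] := hX; rewrite -(law i).
Qed.

Lemma integral_norm_hits_lt T k i :
  (\int[P]_(w in [set w | (hits T w < k)%N]) `|X i w|%:E <=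
   (2 ^+ k * (1 - law_cdf D T / 2) ^+ n.-1)%:E * \int[D]_x `|x|%:E)%E.
Proof.
have mF := measurable_hits_lt T k.
rewrite -(ge0_integral_mrestr _ mF)//; last first.
  by apply/measurable_EFinP; apply: measurableT_comp => //; exact: measurable_funPT.
apply: (@ge0_le_integral_comp _ _ _ _ _ _ D (X i) (fun x : R => `|x|%:E)) => //.
- by apply/measurable_EFinP; exact: normr_measurable.
- by rewrite mulr_ge0 ?exprn_ge0//; have := law_cdf_le1 D T; lra.
- by move=> A mA; rewrite /= /mrestr setIC; exact: hits_lt_bound.
Qed.

(** A crude bound, for the case where n is at most a constant times k. *)
Lemma expectation_ALG_le_mean T k :
  ('E_P[fun w => ALG T k (sample X w)] <= n%:R%:E * \int[D]_x `|x|%:E)%E.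
Proof.
rewrite unlock; apply: (@le_trans _ _ (\int[P]_w \sum_(i < n) `|X i w|%:E)%E).
  apply: le_integral_nomeas => w.
    by apply: sume_ge0 => i _; rewrite lee_fin.
  rewrite sumEFin lee_fin; apply: le_trans (ALG_le_norm _ _ _) _.
  by rewrite /sample big_map big_enum.
rewrite ge0_integral_sum//; last first.
  by move=> i; apply/measurable_EFinP; apply: measurableT_comp => //; exact: measurable_funPT.
rewrite (_ : n%:R%:E * _ = \sum_(i < n) \int[D]_x `|x|%:E)%E; last first.
  by rewrite sumr_const card_ord mule_natl.
apply: lee_sum => i _.
by apply: (@ge0_le_integral_iid i Num.norm) => //; exact: normr_measurable.
Qed.

Lemma expectation_ALG_le T k : 0 <= T ->
  ('E_P[fun w => ALG T k (sample X w)] <= (k%:R * T)%:E +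
   n%:R%:E * ((2 ^+ k * (1 - law_cdf D T / 2) ^+ n.-1)%:E *
     \int[D]_x `|x|%:E))%E.
Proof.
move=> T0; rewrite unlock.
(* With |X i| cut off to the event of fewer than [k] hits, k T + sum Z i dominates [ALG] both on
   this event, as T >= 0, and off it. *)
pose Z i := (fun w => `|X i w|%:E)%E \_ [set w | (hits T w < k)%N].
have Z0 i w : (0 <= Z i w)%E by rewrite /Z /patch; case: ifP.
have mF := measurable_hits_lt T k.
have mZ i : measurable_fun setT (Z i).
  apply/(measurable_restrictT _ mF)/measurable_funTS/measurable_EFinP.
  by apply: measurableT_comp => //; exact: measurable_funPT.
apply: (@le_trans _ _ (\int[P]_w ((k%:R * T)%:E + \sum_(i < n) Z i w))%E).
  apply: le_integral_nomeas => w.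
    by rewrite adde_ge0 ?lee_fin ?mulr_ge0//; apply: sume_ge0 => i _.
  have [hk|kh] := ltnP (hits T w) k.
    have -> : (\sum_(i < n) Z i w = (\sum_(i < n) `|X i w|)%:E)%E.
      by rewrite -sumEFin; apply: eq_bigr => i _; rewrite /Z patchT// inE.
    rewrite -EFinD lee_fin; apply: le_trans (ALG_le_norm _ _ _) _.
    by rewrite /sample big_map big_enum lerDr mulr_ge0.
  apply: (@le_trans _ _ (k%:R * T)%:E).
    by rewrite lee_fin; apply: ALG_le_threshold; rewrite count_sample.
  by rewrite leeDl//; apply: sume_ge0.
rewrite ge0_integralD//; first last.
- exact: emeasurable_sum.
- by move=> w _; apply: sume_ge0.
- by move=> w _; rewrite lee_fin mulr_ge0.
apply: leeD; first by rewrite integral_cst// [X in (_ * X)%E](_ : _ = 1%E) ?mule1//; exact: probability_setT.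
rewrite ge0_integral_sum//.
set c := (_ * \int[D]_x _)%E.
have -> : (n%:R%:E * c = \sum_(i < n) c)%E.
  by rewrite sumr_const card_ord mule_natl.
apply: lee_sum => i _; rewrite -integral_mkcond; exact: integral_norm_hits_lt.
Qed.

(** Expectation of [leq_sum_ltnS] at [h = hits t], whose mean is n F t. *)
Lemma sum_hits_lt_ge t k :
  (k%:R%:E <= \sum_(i < k) P [set w | (hits t w < i.+1)%N] +
    (n%:R * law_cdf D t)%:E)%E.
Proof.
have XE l : [set w | X l w <= t] = X l @^-1` `]-oo, t]%classic.
  by apply/seteqP; split => w /=; rewrite in_itv.
have mI (A : set Omega) : measurable A -> measurable_fun setT (fun w => (\1_A w : R)%:E).
  by move=> mA; apply/measurable_EFinP; exact: measurable_indic.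
have PX l : P [set w | X l w <= t] = (law_cdf D t)%:E.
  by have [_ law] := hX; rewrite EFin_law_cdf XE -(law l).
have -> : (k%:R%:E = \int[P]_w cst (k%:R%:E : \bar R) w)%E.
  by rewrite integral_cst// [X in (_ * X)%E](_ : _ = 1%E) ?mule1//; exact: probability_setT.
have -> : ((n%:R * law_cdf D t)%:E = \sum_(l < n) P [set w | (X l w <= t)%R])%E.
  by rewrite (eq_bigr _ (fun l _ => PX l)) sumEFin sumr_const card_ord mulr_natl.
have int_ind (A : set Omega) : measurable A -> P A = (\int[P]_w (\1_A w)%:E)%E.
  by move=> mA; rewrite integral_indic// setIT.
rewrite (eq_bigr (fun l : 'I_n => \int[P]_w (\1_[set w | (X l w <= t)%R] w)%:E)%E); last first.
  by move=> l _; apply: int_ind; rewrite XE; exact: measurable_funPTI.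
rewrite (eq_bigr (fun i : 'I_k => \int[P]_w (\1_[set w | (hits t w < i.+1)%N] w)%:E)%E); last first.
  by move=> i _; apply: int_ind; exact: measurable_hits_lt.
have mH (j : nat) : measurable [set w | (hits t w < j)%N] by exact: measurable_hits_lt.
have mX' l : measurable [set w | X l w <= t] by rewrite XE; exact: measurable_funPTI.
have mI1 (l : 'I_n) := mI _ (mX' l); have mI2 (i : 'I_k) := mI _ (mH i.+1).
rewrite -!ge0_integral_sum//.
rewrite -ge0_integralD//; first last.
- exact: emeasurable_sum.
- by move=> w _; apply: sume_ge0.
- exact: emeasurable_sum.
- by move=> w _; apply: sume_ge0.
apply: ge0_le_integral_nomeas => w; first by rewrite lee_fin.
rewrite !sumEFin -EFinD lee_fin.
have -> : \sum_(l < n) \1_[set w | X l w <= t] w = (hits t w)%:R :> R.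
  rewrite /hits -sum1_card natr_sum [RHS]big_mkcond/=; apply: eq_bigr => l _.
  rewrite indicE [in RHS]inE; case: ifPn => Xlt; first by rewrite mem_set.
  by rewrite memNset//=; exact/negP.
have -> : \sum_(i < k) \1_[set w | (hits t w < i.+1)%N] w =
    (\sum_(i < k) (hits t w < i.+1)%N)%:R :> R.
  rewrite natr_sum; apply: eq_bigr => i _; rewrite indicE.
  by have [hi|hi] := boolP (hits t w < i.+1)%N; [rewrite mem_set|rewrite memNset//=; exact/negP].
by rewrite -natrD ler_nat leq_sum_ltnS.
Qed.

(** Markov's inequality: with at most [j] hits the order statistic exceeds [t], and elsewhere it is
    almost surely nonnegative. *)
Lemma expectation_order_stat_ge xstar t (j : nat) :
  continuous_on_0_xstar (law_cdf D) xstar -> (j < n)%N -> 0 <= t ->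
  (t%:E * P [set w | (hits t w < j.+1)%N] <=
   'E_P[fun w => order_stat j (sample X w)])%E.
Proof.
move=> hD jn t0; rewrite unlock.
set A := [set w | _]; have mA : measurable A by exact: measurable_hits_lt.
have mneg : measurable_fun [set: measurableTypeR R] (fun x : R => Num.max (- x) 0).
  by apply: measurable_maxr => //; exact: measurable_oppr.
have -> : (t%:E * P A = \int[P]_w (t%:E * (\1_A w)%:E))%E.
  rewrite ge0_integralZl_EFin//; last by apply/measurable_EFinP; exact: measurable_indic.
  by rewrite integral_indic// setIT.
have sX w : (j < size (sample X w))%N by rewrite size_sample.
(* The order statistic is one of the sample values, so its negative part is at most the sum of
   theirs, which integrates to 0. *)
apply: (@integral_ge_nomeas _ _ _ _ _ _ (fun w => \sum_(l < n) (Num.max (- X l w) 0)%:E)%E).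
- by move=> w; rewrite mule_ge0.
- move=> w; rewrite indicE; have [wA|_] := boolP (w \in A); last by rewrite mule0 le_max lexx orbT.
  rewrite mule1 le_max lee_fin ltW//; apply: lt_order_stat => //.
  by rewrite count_sample; move: wA; rewrite inE.
- move=> w; rewrite sumEFin -EFin_max lee_fin.
  have /mapP[l _ ->] := order_stat_mem (sX w).
  by rewrite (bigD1 l)//= lerDl sumr_ge0// => i _; rewrite le_max lexx orbT.
rewrite ge0_integral_sum//; first last.
- by move=> l w _; rewrite lee_fin le_max lexx orbT.
- move=> l; apply/measurable_EFinP; apply: measurable_maxr => //.
  by apply: measurableT_comp => //; exact: measurable_funPT.
apply: big1 => l _; apply/eqP; rewrite eq_le integral_ge0 ?andbT; last first.
  by move=> w _; rewrite lee_fin le_max lexx orbT.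
rewrite -(integral_neg_part hD); apply: (@ge0_le_integral_iid l (fun x => Num.max (- x) 0)) => // x.
by rewrite le_max lexx orbT.
Qed.

Lemma OPT_ge xstar t k : continuous_on_0_xstar (law_cdf D) xstar ->
  (k <= n)%N -> 0 <= t -> ((t * (k%:R - n%:R * law_cdf D t))%:E <= OPT X k)%E.
Proof.
move=> hD kn t0; rewrite /OPT.
apply: (@le_trans _ _ (\sum_(j < k) t%:E * P [set w | (hits t w < j.+1)%N])%E).
  rewrite -ge0_sume_distrr// EFinM lee_wpmul2l// EFinB leeBlDr//.
  exact: sum_hits_lt_ge.
apply: lee_sum => j _; apply: expectation_order_stat_ge hD _ t0.
exact: leq_trans (ltn_ord j) kn.
Qed.

End Sample.

(** * Numerical estimates in [n] and [k] *)

Section Constants.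
Variable R : realType.

(** This is 2 <= e <= 4 raised to the power [k]; e <= 4 comes from exp (- 1/2) >= 1/2. *)
Lemma expR_nat_bounds (k : nat) : 2 ^+ k <= expR k%:R :> R /\ expR k%:R <= 4 ^+ k :> R.
Proof.
rewrite -[k%:R]mul1r expRM_natr; split; apply: lerXn2r; rewrite ?nnegrE ?expR_ge0//.
  exact: expR_ge1Dx.
have h : 2^-1 <= expR (- 2^-1) :> R by apply: le_trans (expR_ge1Dx _); lra.
have e1 : expR 1 * (expR (- 2^-1) * expR (- 2^-1)) = 1 :> R.
  by rewrite -!expRD -[RHS]expR0; congr expR; lra.
have h2 : 4^-1 <= expR (- 2^-1) * expR (- 2^-1) :> R by nra.
have := expR_gt0 (1 : R); nra.
Qed.

(** With p = F T, the hypotheses give (1 - p / 2)^n <= exp (- 2 k) lam^(- 2 k). The first factor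
    absorbs n 2^k <= exp (2 k), and the second is at most lam^2 t / x0. *)
Lemma forced_cost_le (lam x0 t p : R) (n k m : nat) :
  1 < lam -> 0 < x0 -> 4 + 4 * ln lam <= 2 ^+ m -> 0 <= p <= 1 -> (0 < n)%N ->
  n%:R <= expR k%:R :> R -> 2 ^+ m * k%:R <= p * n%:R ->
  x0 < lam ^+ (2 * k + 2) * t ->
  n%:R * (2 ^+ k * (1 - p / 2) ^+ n.-1) <= 2 * lam ^+ 2 / x0 * t.
Proof.
move=> lam1 x00 hm /andP[p0 p1] n0 nk hp x0t.
have lam0 : 0 < lam by lra.
have H1 : (1 - p / 2) ^+ n.-1 <= 2 * expR (- (2 + 2 * ln lam) * k%:R).
  (* The factor 2 pays for one more power, as 1 - p / 2 >= 1/2. *)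
  apply: (@le_trans _ _ (2 * (1 - p / 2) ^+ n)).
    rewrite -[in leRHS](prednK n0) exprSr mulrCA ler_peMr//; last lra.
    by rewrite exprn_ge0//; lra.
  rewrite ler_wpM2l//; apply: le_trans (powB_le_expR _ _) _; first lra.
  rewrite ler_expR; have : 0 <= k%:R :> R by []; nra.
have lamE : expR (- (2 + 2 * ln lam) * k%:R) * (expR k%:R * expR k%:R) * lam ^+ (2 * k) = 1.
  rewrite -{2}(lnK lam0) -expRM_natr -!expRD natrM.
  have -> : - (2 + 2 * ln lam) * k%:R + (k%:R + k%:R) + ln lam * (2 * k%:R) = 0 :> R by ring.
  exact: expR0.
have [k2 _] := expR_nat_bounds k.
have L0 : 0 < lam ^+ (2 * k) by rewrite exprn_gt0.
apply: (@le_trans _ _ (2 / lam ^+ (2 * k))).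
  rewrite ler_pdivlMr//.
  rewrite [leRHS](_ : _ = expR k%:R * (expR k%:R *
    (2 * expR (- (2 + 2 * ln lam) * k%:R))) * lam ^+ (2 * k)); last by move: lamE; lra.
  have q0 : 0 <= (1 - p / 2) ^+ n.-1 by rewrite exprn_ge0//; lra.
  have k0 : 0 <= 2 ^+ k :> R by rewrite exprn_ge0.
  rewrite ler_wpM2r ?(ltW L0)//; apply: ler_pM => //; first exact: mulr_ge0.
  exact: ler_pM.
rewrite ler_pdivrMr// [leRHS](_ : _ = 2 * (lam ^+ (2 * k + 2) * t) / x0); last first.
  by rewrite exprD; ring.
by rewrite ler_pdivlMr// ler_wpM2l// ltW.
Qed.

(** The fraction will be the value of [F] at [t]; the exponent is chosen because 2^(2 k + 2) = 4 *
    4^k >= 4 n. *)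
Lemma lt1_exprn_div (n k : nat) : (0 < k)%N -> (0 < n)%N ->
  n%:R <= expR k%:R :> R -> 1 < 2 ^+ (2 * k + 2) * (k%:R / (2 * n%:R)) :> R.
Proof.
move=> k0 n0 nk; have [_ k4] := expR_nat_bounds k.
rewrite mulrA ltr_pdivlMr ?mulr_gt0 ?ltr0n// mul1r exprD exprM.
rewrite (_ : 2 ^+ 2 = 4); last by rewrite expr2; lra.
have n4 := le_trans nk k4; have nR : 0 < n%:R :> R by rewrite ltr0n.
have kR : 1 <= k%:R :> R by rewrite ler1n.
nra.
Qed.

End Constants.

(** * The competitive ratio and the choice of the threshold *)

Lemma lee_div_of_le (R : realFieldType) (x y : \bar R) (c r : R) :
  0 <= c -> 0 < r -> (x <= (c * r)%:E)%E -> (r%:E <= y)%E -> (x / y <= c%:E)%E.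
Proof.
(* An infinite denominator has inverse 0, so the ratio is then 0. *)
move=> c0 r0 xr; case: y => [y| |//]; last by rewrite invey mule0 lee_fin.
rewrite lee_fin => ry; have y0 := lt_le_trans r0 ry.
rewrite inver gt_eqF// lee_pdivrMr//; apply: le_trans xr _.
by rewrite -EFinM lee_fin ler_wpM2l.
Qed.

Theorem theorem1p7 (R : realType) (D : probability (measurableTypeR R) R)
    (xstar : \bar R) (gamma : R)
    (hD : continuous_on_0_xstar (law_cdf D) xstar)
    (hmean : ('E_D[fun x => x] < +oo)%E)
    (hgamma : min_domain_of_attraction gamma (law_cdf D)) :
  exists C : R, forall n k : nat,
    (0 < k <= n)%N -> ln n%:R <= k%:R :> R ->
    exists T : R,
      forall (d : measure_display) (Omega : measurableType d)
        (P : probability Omega R) (X : 'I_n -> {RV P >-> R}),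
      iid_from D X -> (competitive_ratio X k T <= C%:E)%E.
Proof.
pose F := law_cdf D.
have [lam [x0 [lam1 x00 Fdbl]]] := min_domain_of_attraction_doubling
  (@le_law_cdf _ D) (law_cdf_le1 D) (law_cdf_ge0 D) (law_cdf_eq0 hD) (law_cdf_gt0 hD)
  (let: And3 c _ _ := hD in c 0) hgamma.
have lam0 : 0 < lam by lra.
have [mu [mu0 muE]] : exists mu : R, 0 <= mu /\ (\int[D]_x `|x|%:E = mu%:E)%E.
  have fin : (\int[D]_x `|x|%:E \is a fin_num)%E.
    rewrite ge0_fin_numE; first exact: integral_norm_lty hD hmean.
    by apply: integral_ge0.
  exists (fine (\int[D]_x `|x|%:E)%E); rewrite fineK//; split => //.
  by apply/fine_ge0/integral_ge0.
(* [m] depends on [lam] alone, so the constants built on it involve neither [n] nor [k]. *)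
have [m hm] : exists m : nat, 4 + 4 * ln lam <= 2 ^+ m.
  exists (Num.truncn (4 + 4 * ln lam)).+1; apply: ltW.
  apply: lt_le_trans (truncnS_gt _) _.
  by rewrite -natrX ler_nat ltnW// ltn_expl.
have lamm : 0 < lam ^+ m by rewrite exprn_gt0.
(* A point t <= t1 has room below [x0] for the m + 1 doublings leading to [T]. *)
pose t1 : R := x0 / lam ^+ m.
have t10 : 0 < t1 by rewrite divr_gt0.
have p10 : 0 < F t1 by exact: law_cdf_gt0 hD _ t10.
(* [C1] is the sum of k T and the forced cost over t k / 2, taken at k = 1 for the latter; [C2] is
   the bound k mu / (2 F t1) on n mu, over t1 k / 2. *)
pose C1 : R := 2 * lam ^+ m.+1 + 2 * (2 * lam ^+ 2 / x0) * mu.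
pose C2 : R := mu / (t1 * F t1).
have lamX j : 0 <= lam ^+ j by rewrite exprn_ge0// ltW.
have x0V : 0 <= x0^-1 by rewrite invr_ge0 ltW.
have C10 : 0 <= C1 by do ?[exact: lamX|apply: addr_ge0|apply: mulr_ge0].
have C20 : 0 <= C2 by rewrite divr_ge0// ltW// mulr_gt0.
exists (C1 + C2) => n k /andP[k0 kn] lnk.
have n0 : (0 < n)%N := leq_trans k0 kn.
have nR : 0 < n%:R :> R by rewrite ltr0n.
have kR : 1 <= k%:R :> R by rewrite ler1n.
have nk : n%:R <= expR k%:R :> R by rewrite -[leLHS]lnK// ler_expR.
have [small|large] := lerP (k%:R / (2 * n%:R)) (F t1).
- have [||t /andP[t0' tt1] Ft] := @law_cdf_surj R D xstar hD (k%:R / (2 * n%:R)) t1.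
  + by rewrite small divr_ge0// mulr_ge0.
  + exact: ltW.
  have t0 : 0 < t.
    rewrite lt_neqAle t0' andbT; apply/eqP => t00; move: Ft.
    rewrite -t00 (law_cdf_eq0 hD)// => /esym/eqP; apply/negP.
    by rewrite gt_eqF// divr_gt0 ?mulr_gt0 ?ltr0n.
  pose T : R := lam ^+ m.+1 * t.
  have FT : 2 ^+ m.+1 * F t <= F T.
    apply: iter_doubling lam1 Fdbl _ _ t0 _.
    by rewrite mulrC -ler_pdivlMr.
  have x0t : x0 < lam ^+ (2 * k + 2) * t.
    apply: (doubling_lower_bound lam1 x00 Fdbl (law_cdf_le1 D) t0).
    by rewrite Ft; exact: lt1_exprn_div.
  have FTn : 2 ^+ m * k%:R <= F T * n%:R.
    apply: le_trans (ler_wpM2r (ltW nR) FT).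
    rewrite /F Ft exprS.
    have -> : 2 * 2 ^+ m * (k%:R / (2 * n%:R)) * n%:R = 2 ^+ m * k%:R :> R.
      by field; rewrite gt_eqF.
    by [].
  have FT01 : 0 <= F T <= 1 by rewrite law_cdf_ge0 law_cdf_le1.
  have cost := forced_cost_le lam1 x00 hm FT01 n0 nk FTn x0t.
  exists T => d Omega P X hX; apply: (@lee_div_of_le _ _ _ _ (t * (k%:R / 2))).
  + exact: addr_ge0.
  + by rewrite mulr_gt0// divr_gt0 ?ltr0n.
  + apply: le_trans (expectation_ALG_le hX _ _) _; first by rewrite mulr_ge0// exprn_ge0// ltW.
    rewrite muE -!EFinM -EFinD lee_fin mulrA.
    apply: (@le_trans _ _ (C1 * (t * (k%:R / 2)))); last first.
      by rewrite ler_wpM2r ?lerDl// mulr_ge0 ?divr_ge0// ltW.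
    apply: (@le_trans _ _ (k%:R * T + 2 * lam ^+ 2 / x0 * t * mu)).
      by rewrite lerD2l ler_wpM2r.
    rewrite /C1 /T; set B := 2 * lam ^+ 2 / x0; set L := lam ^+ m.+1.
    have B0 : 0 <= B * t * mu.
      by do ?[exact: lamX|exact: ltW t0|apply: mulr_ge0].
    (* The forced cost carries no factor [k]; k >= 1 supplies it. *)
    have := ler_peMr B0 kR; lra.
  + have := OPT_ge hX hD kn (ltW t0); rewrite Ft.
    have -> : k%:R - n%:R * (k%:R / (2 * n%:R)) = k%:R / 2 :> R.
      by field; rewrite gt_eqF.
    by [].
(* Any threshold works here: n < k / (2 F t1) bounds [ALG], and n F t1 < k / 2 leaves OPT >= t1 k /
   2. *)
- exists 0 => d Omega P X hX; apply: (@lee_div_of_le _ _ _ _ (t1 * (k%:R / 2))).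
  + exact: addr_ge0.
  + by rewrite mulr_gt0// divr_gt0 ?ltr0n.
  + apply: le_trans (expectation_ALG_le_mean hX _ _) _.
    rewrite muE -EFinM lee_fin.
    apply: (@le_trans _ _ (C2 * (t1 * (k%:R / 2)))); last first.
      by rewrite ler_wpM2r ?lerDr// mulr_ge0 ?divr_ge0// ltW.
    have -> : C2 * (t1 * (k%:R / 2)) = k%:R / (2 * F t1) * mu :> R.
      by rewrite /C2; field; rewrite !gt_eqF.
    rewrite ler_wpM2r// ler_pdivlMr ?mulr_gt0//.
    by move: large; rewrite ltr_pdivlMr ?mulr_gt0//; lra.
  + apply: le_trans (OPT_ge hX hD kn (ltW t10)); rewrite lee_fin ler_wpM2l ?(ltW t10)//.
    by move: large; rewrite ltr_pdivlMr ?mulr_gt0// /F; lra.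
Qed.
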